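(* Let $n$ be a positive integer and let $g, g'$ be integers. There exists a chord diagram with $n$ chords and genus range $[g, g']$ whenever $g, g'$ satisfy one of the following conditions: (1) $g' = 2g$ and either $g = 1$ or $g' = \lceil n/2 \rceil$, or (2) $0 \le 2g < g' \le \lceil n/2 \rceil$.
   Context: For integers $a\le b$, $[a,b]=\{k\in\mathbb{Z} : a\le k\le b\}$. A chord diagram with $n$ chords consists of a circle (the backbone) together with $n$ closed arcs (chords) whose $2n$ endpoints are attached to $2n$ distinct points of the circle; the chords are regarded as pairwise disjoint (only the pairing of the points on the circle matters). A thickened chord diagram (thickened diagram) of a chord diagram $D$ is a compact orientable surface obtained as follows: thicken the backbone to an annulus, which has an inner and an outer boundary circle; for each endpoint of each chord choose, independently, the inner or the outer boundary circle; then for each chord attach a band (a thickened chord) whose two ends are glued to the annulus at the positions of the two endpoints of the chord, each on the chosen boundary circle, in such a way that the resulting surface is orientable. Thus a diagram with $n$ chords has $4^n$ thickened diagrams. The genus $g(F)$ of a compact connected orientable surface $F$ with $b(F)$ boundary components is determined by $\chi(F)=2-2g(F)-b(F)$, where $\chi$ is the Euler characteristic. The genus range of $D$ is $\mathrm{gr}(D)=\{g(F) : F \text{ is a thickened chord diagram of } D\}$.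
   Formalization: The formal theorem also assumes g' ≤ ⌈n/2⌉, which only excludes n = 1, 2 in the case g = 1, g' = 2 of condition (1); there the claim is false, since every thickened diagram with n chords has genus at most ⌈n/2⌉ = 1. *)

(* Defs.v *)
From HB Require Import structures.
From mathcomp Require Import all_boot all_order all_algebra.
Set Implicit Arguments.
Unset Strict Implicit.
Unset Printing Implicit Defensive.
Import Order.TTheory GRing.Theory Num.Theory.

(* A compact oriented surface presented by gluing oriented polygons.  [next]
   maps a side to the following side of the same polygon in counterclockwise
   order, so the polygons are the [next]-cycles.  Two distinct sides s and
   [glue s] are identified by an orientation-reversing homeomorphism, so that
   the resulting surface is orientable; a side fixed by [glue] is left free and
   lies on the boundary of the surface. *)
Record polygonal_surface := PolygonalSurface {
  side : finType;
  next : side -> side;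
  glue : side -> side;
  next_inj : injective next;
  glueK : involutive glue
}.

Section Surface.
Variable F : polygonal_surface.
Implicit Types s t : side F.

(* The origin of s is the end of [glue s], i.e. the origin of
   [next (glue s)]. *)
Definition origin_glued s t := (glue s != s) && (t == next (glue s)).

(* The vertices of the surface are the classes, under [same_origin], of the
   origins of all the sides. *)
Definition same_origin := connect [rel s t | origin_glued s t || origin_glued t s].

Definition num_vertices : nat :=
  n_comp [rel s t | origin_glued s t || origin_glued t s] predT.
Definition num_edges : nat := fcard (@glue F) predT.
Definition num_faces : nat := fcard (@next F) predT.

Definition euler_char : int :=
  (num_vertices%:Z - num_edges%:Z + num_faces%:Z)%R.

Definition free_side : pred (side F) := [pred s | glue s == s].

Definition boundary_follows s t :=
  [&& free_side s, free_side t & same_origin (next s) t].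

(* The number of connected components of the graph formed by the free sides. *)
Definition num_boundary : nat :=
  n_comp [rel s t | boundary_follows s t || boundary_follows t s] free_side.

(* Meaningful for connected surfaces. *)
Definition has_genus (g : int) : Prop :=
  (euler_char = 2 - 2 * g - num_boundary%:Z)%R.

End Surface.

(* The 2n endpoints are numbered 0, ..., 2n-1 in counterclockwise order along
   the backbone, with 2n-1 cyclically followed by 0. *)
Record chord_diagram (n : nat) := ChordDiagram {
  partner : 'I_n.*2 -> 'I_n.*2;
  partnerK : involutive partner;
  partner_neq : forall p, partner p != p
}.

Notation outer := true (only parsing).
Notation inner := false (only parsing).
Notation ahead := true (only parsing).
Notation behind := false (only parsing).

(* Radial cuts between consecutive endpoints divide the annulus into 2n
   rectangles, one around each endpoint p.  Its sides are the arcs [Arc outer]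
   and [Arc inner] of the two boundary circles, and the cuts [Cut ahead] and
   [Cut behind] separating it from the rectangles of the next and of the
   previous endpoint.
   The band of a chord {p, q} is a rectangle with sides, in counterclockwise
   order, (p, BandEnd), (p, BandFlank), (q, BandEnd), (q, BandFlank); the two
   [BandEnd]s are the sides glued to the annulus. *)
Inductive side_kind := Arc of bool | Cut of bool | BandEnd | BandFlank.

Definition side_kind_code (k : side_kind) : bool + bool + bool :=
  match k with
  | Arc b => inl (inl b)
  | Cut b => inl (inr b)
  | BandEnd => inr true
  | BandFlank => inr false
  end.

Definition side_kind_decode (x : bool + bool + bool) : side_kind :=
  match x with
  | inl (inl b) => Arc b
  | inl (inr b) => Cut b
  | inr true => BandEnd
  | inr false => BandFlank
  end.

Lemma side_kind_codeK : cancel side_kind_code side_kind_decode.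
Proof. by case. Qed.

HB.instance Definition _ := Finite.copy side_kind (can_type side_kind_codeK).

Section Thickening.
Variables (n : nat) (D : chord_diagram n).

(* c p is the boundary circle of the annulus to which the band is attached at
   the endpoint p. *)
Variable c : {ffun 'I_n.*2 -> bool}.

Definition thick_side : finType := ('I_n.*2 * side_kind)%type.

Definition thick_next (s : thick_side) : thick_side :=
  let: (p, k) := s in
  match k with
  | Arc outer => (p, Cut ahead)
  | Cut ahead => (p, Arc inner)
  | Arc inner => (p, Cut behind)
  | Cut behind => (p, Arc outer)
  | BandEnd => (p, BandFlank)
  | BandFlank => (partner D p, BandEnd)
  end.

Definition thick_glue (s : thick_side) : thick_side :=
  let: (p, k) := s in
  match k with
  | Arc b => if c p == b then (p, BandEnd) else (p, Arc b)
  | Cut ahead => (ordS p, Cut behind)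
  | Cut behind => (ord_pred p, Cut ahead)
  | BandEnd => (p, Arc (c p))
  | BandFlank => (p, BandFlank)
  end.

Lemma thick_next_inj : injective thick_next.
Proof.
move=> [p [[]|[]||]] [q [[]|[]||]] //= [] // => [->|->|->|->|->|] //.
by move/(inv_inj (partnerK D))->.
Qed.

Lemma thick_glueK : involutive thick_glue.
Proof.
case=> p [b|[]||] //=.
- by case: ifP => [/eqP <- //|cpb] /=; rewrite cpb.
- by rewrite ordSK.
- by rewrite ord_predK.
- by rewrite eqxx.
Qed.

Definition thickened_diagram : polygonal_surface :=
  PolygonalSurface thick_next_inj thick_glueK.

End Thickening.

Definition genus_range (n : nat) (D : chord_diagram n) (k : int) : Prop :=
  exists c : {ffun 'I_n.*2 -> bool}, has_genus (thickened_diagram D c) k.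

(* Main.v *)
Require Import Defs.
From mathcomp Require Import all_boot all_order all_algebra.
From mathcomp Require Import fingroup perm zify.
Set Implicit Arguments.
Unset Strict Implicit.
Unset Printing Implicit Defensive.

(** Let F be a thickened diagram with n chords.  It is an annulus with n bands,
    so its Euler characteristic is -n and its genus is (n + 2 - b) / 2, where b
    is the number of boundary circles.  Walking along the boundary with the
    surface on the left, one goes from endpoint to endpoint along the outer
    circle counterclockwise and along the inner circle clockwise, and crosses
    over to the partner of each endpoint at which a band is attached.  Hence b
    is the number of cycles of a permutation of the pairs (endpoint, circle)
    ([has_genus_thickened]).

    Cut the backbone open between the last and the first endpoint.  The boundary
    walk enters the cut diagram by two strands, an outer one before the first
    endpoint and an inner one after the last endpoint.  Either both strands
    traverse the diagram, or both turn back ([turns]).  When two diagrams are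
    placed one after the other on a common backbone, the permutation of the
    whole is the disjoint union of the two permutations followed by two
    transpositions.  Counting cycles, the genera add up, except that 1 is lost
    when both diagrams turn; and the whole turns iff one of the parts does
    ([genus_concat_at], [turns_concat_at]).

    The pairs (genus, turns) that a concatenation attains are therefore
    determined by those of its parts.  Four parts suffice, and their pairs are
    found by running through all their thickenings:
    - arch (one chord): (0, no), (1, yes);
    - crossing (two crossing chords): (0, no), (1, no), (1, yes);
    - triangle (three pairwise crossing chords): (1, no), (1, yes), (2, yes);
    - arched triangle (a triangle under an arch): (1, no), (2, no), (2, yes).

    A crossing in front of a diagram of genus range [lo, hi] makes the range
    [lo, hi + 1], at the cost of two chords.  An arched triangle makes it
    [lo + 1, hi + 2], at the cost of four chords: a turning arched triangle has
    genus 2, so that it still contributes 1 after the possible loss of 1.  An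
    arch can be put for one chord in front of a diagram that turns whenever its
    genus is hi, and leaves its range unchanged.  In condition (2) one combines
    g arched triangles, g' - 2g - 1 crossings and arches; the number of arches
    is n - 2g' + 2, which is positive exactly because g' <= ceil(n / 2).  For
    g = 1 and g' = 2 one takes n - 3 arches and a triangle.  Finally
    g' = 2g = ceil(n / 2) means that n = 4g - 1 or n = 4g, and one takes g - 1
    arched triangles with a triangle or another arched triangle. *)

(** * Counting connected components *)

Lemma n_comp_imset (T U : finType) (e : rel T) (a : pred T) (r : T -> U) :
    connect_sym e -> closed e a ->
    {in a &, forall x y, connect e x y = (r x == r y)} ->
  n_comp e a = #|[set r x | x in a]|.
Proof.
move=> sym_e cl_a r_class.
rewrite /n_comp_mem -(@card_in_imset _ _ r [predI roots e & a]).
  apply: eq_card => u; apply/imsetP/imsetP=> [[x /andP[_ ax] ->]|[x ax ->]].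
    by exists x.
  have a_root : fingraph.root e x \in a.
    by rewrite -(closed_connect cl_a (connect_root e x)).
  exists (fingraph.root e x).
    by apply/andP; split; first exact: (roots_root sym_e).
  by apply/eqP; rewrite -r_class ?connect_root.
move=> x y /andP[/eqP rx ax] /andP[/eqP ry ay] /eqP.
by rewrite -r_class // -(root_connect sym_e) rx ry => /eqP.
Qed.

(** Used for the vertices and the edges of a thickened diagram, where an explicit
    normal form [s (r x)] of each cell is at hand. *)
Lemma n_comp_section (T U : finType) (e : rel T) (r : T -> U) (s : U -> T) :
    connect_sym e -> (forall x y, e x y -> r x = r y) -> cancel s r ->
    (forall x, connect e x (s (r x))) ->
  (forall x y, connect e x y = (r x == r y)) /\ n_comp e predT = #|U|.
Proof.
move=> sym_e e_r sK es.
have r_class x y : connect e x y = (r x == r y).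
  apply/idP/eqP=> [/connectP[p + ->]|r_xy].
    elim: p x => //= z p IHp x /andP[/e_r -> ]; exact: IHp.
  by apply: connect_trans (es x) _; rewrite r_xy sym_e.
split=> //; rewrite (n_comp_imset sym_e _ (in2W r_class)) //.
rewrite -cardsT; congr #|pred_of_set _|; apply/setP=> u; rewrite inE.
by apply/imsetP; exists (s u).
Qed.

Lemma symmetrized_connect_sym (T : finType) (e : rel T) :
  connect_sym [rel x y | e x y || e y x].
Proof. by apply: sym_connect_sym => x y /=; rewrite orbC. Qed.

(** * The boundary permutation of a thickened diagram *)

Section Boundary.
Variables (n : nat) (D : chord_diagram n) (c : {ffun 'I_n.*2 -> bool}).
Implicit Types x y : 'I_n.*2 * bool.

(** The state (p, b) is the arrival of the boundary walk at endpoint p along the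
    circle b of the annulus.  If a band is attached there, the walk follows its
    flank and leaves from the other end of the band. *)
Definition cross x :=
  if c x.1 == x.2 then (partner D x.1, c (partner D x.1)) else x.

(** The surface is on the left of the walk, so the outer circle is run
    counterclockwise and the inner one clockwise. *)
Definition advance x : 'I_n.*2 * bool :=
  (if x.2 then ordS x.1 else ord_pred x.1, x.2).

Lemma crossK : involutive cross.
Proof.
case=> p b; rewrite /cross /=; case: (eqVneq (c p) b) => [<-|/negPf -> //] /=.
by rewrite eqxx partnerK.
Qed.

Lemma advance_inj : injective advance.
Proof.
case=> [p b] [q d] eq_pq; have /= eq_bd := congr1 snd eq_pq.
have /= := congr1 fst eq_pq; rewrite -{}eq_bd.
by case: b {eq_pq} => [/ordS_inj|/ord_pred_inj] ->.
Qed.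

Lemma advance_cross_inj : injective (advance \o cross).
Proof. exact: inj_comp advance_inj (inv_inj crossK). Qed.

Definition boundary_perm : {perm 'I_n.*2 * bool} := perm advance_cross_inj.

Lemma boundary_permE x : boundary_perm x = advance (cross x).
Proof. by rewrite permE. Qed.

Local Notation F := (thickened_diagram D c).
Local Notation origin_rel := [rel s t | @origin_glued F s t || origin_glued t s].

(** The states correspond to the free sides: a state at which a band is attached
    stands for the flank that replaces the covered arc. *)
Definition boundary_side x : side F :=
  if c x.1 == x.2 then (x.1, BandFlank) else (x.1, Arc x.2).

(** The origin of each side is the origin of exactly one free side, so the
    states also serve as names for the vertices. *)
Definition vertex_of (s : side F) : 'I_n.*2 * bool :=
  let: (p, k) := s in
  match k with
  | Arc b => (p, b)
  | Cut outer => (ordS p, outer)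
  | Cut inner => (ord_pred p, inner)
  | BandEnd => advance (p, c p)
  | BandFlank => (p, c p)
  end.

Lemma boundary_sideK : cancel boundary_side vertex_of.
Proof. by case=> p b; rewrite /boundary_side /=; case: eqP => //= ->. Qed.

Lemma vertex_of_glued (s t : side F) : origin_glued s t -> vertex_of s = vertex_of t.
Proof.
case/andP; case: s => p [b|[]||] /=.
- by case: ifP => [/eqP<- _ /eqP->|] //=; rewrite eqxx.
- by move=> _ /eqP->.
- by move=> _ /eqP->.
- by move=> _ /eqP->; rewrite /advance; case: (c p).
- by rewrite eqxx.
Qed.

Lemma connect_boundary_side (s : side F) :
  connect origin_rel s (boundary_side (vertex_of s)).
Proof.
have arc p b : connect origin_rel (p, Arc b) (boundary_side (p, b)).
  rewrite /boundary_side /=; case cp: (c p == b); last exact: connect0.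
  by apply: connect1; rewrite /= /origin_glued /= cp xpair_eqE eqxx andbF /= eqxx.
have cut p b : connect origin_rel (p, Cut b) (boundary_side (vertex_of (p, Cut b))).
  by case: b; apply: connect_trans (arc _ _); apply: connect1;
     rewrite /= /origin_glued /= xpair_eqE andbF /= eqxx.
case: s => p [b|b||] //.
  apply: connect_trans (_ : connect _ _ (p, Cut (c p))) _; last first.
    by have := cut p (c p); rewrite /= /advance; case: (c p).
  apply: connect1; rewrite /= /origin_glued /= xpair_eqE andbF /=.
  by case: (c p); rewrite eqxx.
by rewrite /boundary_side /= eqxx connect0.
Qed.

Lemma vertices_thickened :
  (forall s t : side F, same_origin s t = (vertex_of s == vertex_of t)) /\
  num_vertices F = n * 4.
Proof.
have [|s t /=|same_class n_class] :=
  n_comp_section _ _ boundary_sideK connect_boundary_side.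
- exact: symmetrized_connect_sym.
- by case/orP=> /vertex_of_glued.
by split=> //; rewrite [LHS]n_class card_prod card_ord card_bool; lia.
Qed.

(** A cut belongs to the rectangles of two endpoints; it is filed under the one
    behind it. *)
Definition edge_of (s : side F) : 'I_n.*2 * (bool * bool) :=
  let: (p, k) := s in
  match k with
  | Arc b => (p, (true, c p == b))
  | Cut outer => (p, (false, true))
  | Cut inner => (ord_pred p, (false, true))
  | BandEnd => (p, (true, true))
  | BandFlank => (p, (false, false))
  end.

Definition edge_side (u : 'I_n.*2 * (bool * bool)) : side F :=
  let: (p, k) := u in
  match k with
  | (true, b) => (p, Arc (c p == b))
  | (false, true) => (p, Cut outer)
  | (false, false) => (p, BandFlank)
  end.

Lemma num_edges_thickened : num_edges F = n * 8.
Proof.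
have glue_sym : connect_sym (frel (@glue F)).
  exact: fconnect_sym (inv_inj (@glueK F)).
have [|||_ n_class] := @n_comp_section _ _ (frel (@glue F)) edge_of edge_side glue_sym.
- case=> p [b|[]||] t /= /eqP <- //=; last by rewrite eqxx.
    by case cp: (c p == b) => /=; rewrite ?cp.
  by rewrite ordSK.
- by case=> p [[] []] //=; case: (c p).
- case=> p [b|[]||] /=; do ?exact: connect0.
  + by case: (c p); case: b; apply: connect0.
  + by apply: connect1; rewrite /= eqxx.
  + by apply: connect1; rewrite /= eqb_id eqxx.
by rewrite [LHS]n_class !card_prod card_ord card_bool; lia.
Qed.

(** Annulus rectangles and bands all have four sides, so there are a quarter as
    many faces as sides. *)
Lemma num_faces_thickened : num_faces F = n * 3.
Proof.
have next_order (s : side F) : fingraph.order (@Defs.next F) s = 4.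
  pose p := s.1; pose q := partner D p.
  have [|] := boolP (s \in [:: (p, Arc outer); (p, Cut ahead);
                               (p, Arc inner); (p, Cut behind)]).
    apply: order_cycle; first by rewrite /= !eqxx.
    by rewrite /= !inE !xpair_eqE !andbF.
  have q_p : q != p by apply: partner_neq.
  move=> sNin.
  have : s \in [:: (p, BandEnd); (p, BandFlank); (q, BandEnd); (q, BandFlank)].
    move: sNin; rewrite /p.
    by case: (s) => p' [[]|[]||]; rewrite /= !inE !xpair_eqE /= !eqxx.
  apply: order_cycle; first by rewrite /= partnerK !eqxx.
  by rewrite /= !inE !xpair_eqE /= !andbF ![p == q]eq_sym (negPf q_p).
have := @fcard_order_set _ _ (@next_inj F) 4 predT.
rewrite card_prod card_ord => cardF.
have : fcard (@Defs.next F) predT * 4 = n.*2 * #|{: side_kind}|.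
  by apply: cardF => //; apply/subsetP=> s _; rewrite inE next_order.
have -> : #|{: side_kind}| = 6.
  have code_bij : bijective side_kind_code.
    by exists side_kind_decode; [exact: side_kind_codeK | case=> [[]|[]]].
  by rewrite (bij_eq_card code_bij) !card_sum card_bool.
by rewrite /num_faces; lia.
Qed.

(** Through [boundary_side], the relation [boundary_follows] is the graph of
    [boundary_perm], and boundary circles are its cycles. *)
Lemma num_boundary_thickened : num_boundary F = #|porbits boundary_perm|.
Proof.
have [same_vertex _] := vertices_thickened.
pose e := [rel s t : side F | boundary_follows s t || boundary_follows t s].
have e_sym : connect_sym e by exact: symmetrized_connect_sym.
have free_boundary x : free_side (boundary_side x).
  case: x => p b; rewrite /boundary_side /free_side /=.
  by case cp: (c p == b); rewrite /= ?cp eqxx.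
have vertex_ofK s : free_side s -> boundary_side (vertex_of s) = s.
  case: s => p [b|[]||]; rewrite /free_side /boundary_side /= ?xpair_eqE;
    rewrite ?andbF ?eqxx //.
  by case: ifP => //; rewrite xpair_eqE andbF.
have vertex_next x : vertex_of (Defs.next (boundary_side x)) = boundary_perm x.
  case: x => p b; rewrite boundary_permE /cross /boundary_side /=.
  by case: ifP => //=; case: b.
have followsE x y :
    boundary_follows (boundary_side x) (boundary_side y) = (boundary_perm x == y).
  by rewrite /boundary_follows !free_boundary same_vertex vertex_next boundary_sideK.
have closed_free : closed e (@free_side F).
  by move=> s t /orP[] /and3P[]; rewrite -!topredE /= => -> ->.
rewrite /num_boundary -/e (@n_comp_imset _ _ e _ (porbit boundary_perm \o vertex_of)) //.
  rewrite /porbits; apply: eq_card => X; apply/imsetP/imsetP=> -[x _ ->].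
    by exists (vertex_of x).
  exists (boundary_side x); first exact: free_boundary.
  by rewrite /= boundary_sideK.
move=> s t /vertex_ofK <- /vertex_ofK <-; set x := vertex_of s; set y := vertex_of t.
rewrite /= !boundary_sideK; apply/idP/eqP=> [xy|xy].
  have e_porbit u v : e u v ->
      porbit boundary_perm (vertex_of u) = porbit boundary_perm (vertex_of v).
    have step w z : boundary_follows w z ->
        porbit boundary_perm (vertex_of w) = porbit boundary_perm (vertex_of z).
      move=> wz; have /and3P[/vertex_ofK wE /vertex_ofK zE _] := wz.
      move: wz; rewrite -wE -zE followsE !boundary_sideK => /eqP <-.
      by rewrite (porbit_perm _ 1).
    by case/orP=> /step.
  have connect_porbit u v : connect e u v ->
      porbit boundary_perm (vertex_of u) = porbit boundary_perm (vertex_of v).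
    case/connectP=> p + ->.
    by elim: p u => //= w p IHp u /andP[/e_porbit -> /IHp].
  by have := connect_porbit _ _ xy; rewrite !boundary_sideK.
have /porbitP[i ->] : y \in porbit boundary_perm x by rewrite -eq_porbit_mem xy.
elim: i => [|i IHi]; first by rewrite perm1 connect0.
by apply: connect_trans IHi (connect1 _); rewrite /= followsE expgSr permM eqxx.
Qed.

(** The Euler characteristic is 4n - 8n + 3n = -n. *)
Lemma has_genus_thickened (k : int) :
  has_genus F k <-> (#|porbits boundary_perm|%:Z + k * 2 = n%:Z + 2)%R.
Proof.
rewrite /has_genus /euler_char num_edges_thickened num_faces_thickened.
by rewrite num_boundary_thickened vertices_thickened.2; lia.
Qed.

End Boundary.

(** * Cycles of spliced permutations *)

Section PermutationCycles.
Local Open Scope group_scope.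

Lemma porbit_closed (T : finType) (t : {perm T}) (B : pred T) x :
  (forall z, B z -> B (t z)) -> B x -> forall y, y \in porbit t x -> B y.
Proof.
move=> tB Bx _ /porbitP[i ->].
by elim: i => [|i IHi]; rewrite ?perm1 // expgSr permM; apply: tB.
Qed.

(** If t imitates s until s reaches x or y, then the t-orbit of x reaches the
    value y' that replaces y: otherwise the points imitated in that orbit would
    be closed under s without ever leading to y. *)
Lemma porbit_follow (T U : finType) (s : {perm T}) (t : {perm U}) (f : T -> U) x y y' :
    (forall z, s z != x -> s z != y -> t (f z) = f (s z)) ->
    (forall z, s z = y -> t (f z) = y') ->
  y \in porbit s x -> y' \in porbit t (f x).
Proof.
move=> t_s t_y xy; apply: contraT => Ny'.
pose B := [pred z | f z \in porbit t (f x)].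
have B_t z : B z -> t (f z) \in porbit t (f x).
  by rewrite /B /= -!eq_porbit_mem => /eqP<-; rewrite (porbit_perm t 1).
have B_y z : B z -> s z != y.
  by move=> /B_t; apply: contraTneq => /t_y ->.
have B_s z : B z -> B (s z).
  move=> Bz; have [->|sz_x] := eqVneq (s z) x; first exact: porbit_id.
  by have := B_t z Bz; rewrite t_s // B_y.
have : B (s^-1 y).
  apply: porbit_closed B_s (porbit_id _ _ : B x) _ _.
  by rewrite -eq_porbit_mem -(porbit_perm s 1) expg1 permKV eq_porbit_mem.
by move/B_y; rewrite permKV eqxx.
Qed.

Lemma card_porbits_bij (T U : finType) (s : {perm T}) (t : {perm U}) (f : T -> U) :
    bijective f -> (forall x, f (s x) = t (f x)) ->
  (forall x y, (f x \in porbit t (f y)) = (x \in porbit s y)) /\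
  #|porbits s| = #|porbits t|.
Proof.
move=> [g fK gK] f_s.
have f_porbit x y : (f x \in porbit t (f y)) = (x \in porbit s y).
  have f_iter i : f ((s ^+ i) y) = (t ^+ i) (f y).
    by elim: i => [|i IHi]; rewrite ?perm1 // !expgSr !permM f_s IHi.
  apply/porbitP/porbitP=> -[i xE]; exists i; last by rewrite xE f_iter.
  by apply: (can_inj fK); rewrite f_iter.
split=> //; pose h (X : {set T}) := f @: X.
have hE x : h (porbit s x) = porbit t (f x).
  apply/setP=> y; rewrite -[y]gK f_porbit.
  by apply/imsetP/idP=> [[z xz /(can_inj fK)->]|gy_x] //; exists (g y).
rewrite -(card_imset _ (imset_inj (can_inj fK) : injective h)).
apply: eq_card => X; apply/imsetP/imsetP=> [[_ /imsetP[x _ ->] ->]|[y _ ->]].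
  by exists (f x); rewrite ?hE.
by exists (porbit s (g y)); rewrite ?hE ?gK // imset_f.
Qed.

Lemma porbits_mul_tpermr (T : finType) (s : {perm T}) x y :
  (#|porbits (s * tperm x y)| + (x \notin porbit s y).*2 = #|porbits s| + (x != y))%N.
Proof.
by rewrite -porbitsV invMg tpermV -[porbits s]porbitsV -porbitV porbits_mul_tperm.
Qed.

Section Splice.
Variables (T1 T2 : finType) (s1 : {perm T1}) (s2 : {perm T2}).
Variables (x1 y1 : T1) (x2 y2 : T2).
Hypotheses (x1y1 : x1 != y1) (x2y2 : x2 != y2).

Definition sum_map (u : T1 + T2) : T1 + T2 :=
  match u with inl z => inl (s1 z) | inr z => inr (s2 z) end.

Lemma sum_map_inj : injective sum_map.
Proof. by case=> u [] v //= [] /perm_inj->. Qed.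

Definition sum_perm : {perm T1 + T2} := perm sum_map_inj.

Lemma sum_permE u : sum_perm u = sum_map u.
Proof. exact: permE. Qed.

Lemma porbit_sum_inl z w : (inl z \in porbit sum_perm (inl w)) = (z \in porbit s1 w).
Proof.
apply/idP/idP=> zw; last first.
  by apply: (porbit_follow (f := inl)) zw => v; rewrite permE //= => ->.
pose B (u : T1 + T2) := if u is inl v then v \in porbit s1 w else false.
suff : B (inl z) by []; apply: porbit_closed zw; last exact: porbit_id.
by case=> //= v; rewrite permE /= -!eq_porbit_mem (porbit_perm s1 1).
Qed.

Lemma porbit_sum_inr z w : (inr z \in porbit sum_perm (inr w)) = (z \in porbit s2 w).
Proof.
apply/idP/idP=> zw; last first.
  by apply: (porbit_follow (f := inr)) zw => v; rewrite permE //= => ->.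
pose B (u : T1 + T2) := if u is inr v then v \in porbit s2 w else false.
suff : B (inr z) by []; apply: porbit_closed zw; last exact: porbit_id.
by case=> //= v; rewrite permE /= -!eq_porbit_mem (porbit_perm s2 1).
Qed.

Lemma porbit_sum_inlr z w : inl z \notin porbit sum_perm (inr w).
Proof.
apply/negP=> zw.
pose B (u : T1 + T2) := if u is inr _ then true else false.
suff : B (inl z) by []; apply: porbit_closed zw => //.
by case=> //= v; rewrite permE.
Qed.

Lemma card_porbits_sum : (#|porbits sum_perm| = #|porbits s1| + #|porbits s2|)%N.
Proof.
have inl_inj : injective (@inl T1 T2) by move=> u v [].
have inr_inj : injective (@inr T1 T2) by move=> u v [].
have porbit_inl z : porbit sum_perm (inl z) = inl @: porbit s1 z.
  apply/setP=> -[] w; first by rewrite porbit_sum_inl (mem_imset _ _ inl_inj).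
  rewrite porbit_sym (negPf (porbit_sum_inlr _ _)).
  by apply/esym/negP=> /imsetP[].
have porbit_inr z : porbit sum_perm (inr z) = inr @: porbit s2 z.
  apply/setP=> -[] w; last by rewrite porbit_sum_inr (mem_imset _ _ inr_inj).
  rewrite (negPf (porbit_sum_inlr _ _)).
  by apply/esym/negP=> /imsetP[].
have -> : porbits sum_perm =
    [set inl @: X | X : {set T1} in porbits s1] :|:
    [set inr @: X | X : {set T2} in porbits s2].
  apply/setP=> X; rewrite !inE.
  apply/imsetP/orP=> [[[z|z] _ ->]|[]/imsetP[_ /imsetP[z _ ->] ->]].
  - by left; rewrite porbit_inl !imset_f.
  - by right; rewrite porbit_inr !imset_f.
  - by exists (inl z); rewrite ?porbit_inl.
  - by exists (inr z); rewrite ?porbit_inr.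
rewrite cardsU (card_imset _ (imset_inj inl_inj)) (card_imset _ (imset_inj inr_inj)).
rewrite [X in _ - X](_ : _ = 0) ?subn0 //; apply/eqP; rewrite cards_eq0.
apply/eqP/setP=> X; rewrite !inE; apply/andP=> -[] /imsetP[_ /imsetP[z _ ->] ->].
case/imsetP=> Y _ /setP/(_ (inl z)).
by rewrite (mem_imset _ _ inl_inj) porbit_id => /esym/imsetP[].
Qed.

(** For the boundary permutations of two diagrams cut open, x_i is the outer
    strand entering on one side and y_i the inner strand entering on the other;
    the transpositions pass on to the second diagram what used to come back to
    the first one, and conversely. *)
Definition splice : {perm T1 + T2} :=
  sum_perm * tperm (inl x1) (inr x2) * tperm (inl y1) (inr y2).

Let half_splice := sum_perm * tperm (inl x1) (inr x2).

Let half_inl z : half_splice (inl z) = if s1 z == x1 then inr x2 else inl (s1 z).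
Proof.
rewrite permM sum_permE /=; case: eqP => [->|sz]; first exact: tpermL.
by rewrite tpermD //; apply/eqP=> -[/esym].
Qed.

Let half_inr z : half_splice (inr z) = if s2 z == x2 then inl x1 else inr (s2 z).
Proof.
rewrite permM sum_permE /=; case: eqP => [->|sz]; first exact: tpermR.
by rewrite tpermD //; apply/eqP=> -[/esym].
Qed.

Lemma splice_inl z :
  splice (inl z) =
    if s1 z == x1 then inr x2 else if s1 z == y1 then inr y2 else inl (s1 z).
Proof.
rewrite permM half_inl; case: eqP => [_|_].
  by rewrite tpermD //; apply/eqP=> -[/esym/eqP]; rewrite (negPf x2y2).
case: eqP => [->|sz]; first exact: tpermL.
by rewrite tpermD //; apply/eqP=> -[/esym].
Qed.

Lemma splice_inr z :
  splice (inr z) =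
    if s2 z == x2 then inl x1 else if s2 z == y2 then inl y1 else inr (s2 z).
Proof.
rewrite permM half_inr; case: eqP => [_|_].
  by rewrite tpermD //; apply/eqP=> -[/esym/eqP]; rewrite (negPf x1y1).
case: eqP => [->|sz]; first exact: tpermR.
by rewrite tpermD //; apply/eqP=> -[/esym].
Qed.

(** If x1 leads to y1 in s1, then in the spliced permutation it leads to y2
    instead, and if y2 leads to x2 in s2, it now leads to x1.  If neither
    happens, the cycles of x1 and x2 merge into a set that avoids y2. *)
Lemma porbit_splice :
  (inr y2 \in porbit splice (inl x1)) = (y1 \in porbit s1 x1) || (y2 \in porbit s2 x2).
Proof.
apply/idP/orP=> [|[xy1|xy2]].
- move=> x1_y2; apply/orP; apply: contraT; rewrite negb_or => /andP[Nxy1 Nxy2].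
  pose B (u : T1 + T2) :=
    match u with inl z => z \in porbit s1 x1 | inr z => z \in porbit s2 x2 end.
  suff : B (inr y2) by rewrite /B (negPf Nxy2).
  apply: porbit_closed x1_y2; last exact: porbit_id.
  case=> z /= Bz.
    have Bsz : s1 z \in porbit s1 x1.
      by move: Bz; rewrite -!eq_porbit_mem (porbit_perm s1 1).
    rewrite splice_inl; case: eqP => [_|_]; first exact: porbit_id.
    by case: eqP => // szy; rewrite szy (negPf Nxy1) in Bsz.
  have Bsz : s2 z \in porbit s2 x2.
    by move: Bz; rewrite -!eq_porbit_mem (porbit_perm s2 1).
  rewrite splice_inr; case: eqP => [_|_]; first exact: porbit_id.
  by case: eqP => // szy; rewrite szy (negPf Nxy2) in Bsz.
- apply: (porbit_follow (f := inl)) xy1 => z; rewrite splice_inl.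
    by move=> /negPf -> /negPf ->.
  by move=> ->; rewrite eq_sym (negPf x1y1) eqxx.
rewrite porbit_sym; rewrite porbit_sym in xy2.
apply: (porbit_follow (f := inr)) xy2 => z; rewrite splice_inr.
  by move=> /negPf -> /negPf ->.
by move=> ->; rewrite eqxx.
Qed.

Let porbit_half :
  (inl y1 \in porbit half_splice (inr y2)) =
    (y1 \in porbit s1 x1) && (y2 \in porbit s2 x2).
Proof.
apply/idP/andP=> [y12|[xy1 xy2]].
  split; apply: contraTT y12.
    rewrite porbit_sym => Nxy1; rewrite porbit_sym; apply/negP=> y12.
    pose B (u : T1 + T2) := if u is inl v then v \in porbit s1 y1 else false.
    suff : B (inr y2) by []; apply: porbit_closed y12; last exact: porbit_id.
    case=> //= z Bz; rewrite half_inl.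
    have Bsz : s1 z \in porbit s1 y1.
      by move: Bz; rewrite -!eq_porbit_mem (porbit_perm s1 1).
    by case: eqP => // szx; rewrite szx (negPf Nxy1) in Bsz.
  rewrite porbit_sym => Nxy2; apply/negP=> y12.
  pose B (u : T1 + T2) := if u is inr v then v \in porbit s2 y2 else false.
  suff : B (inl y1) by []; apply: porbit_closed y12; last exact: porbit_id.
  case=> //= z Bz; rewrite half_inr.
  have Bsz : s2 z \in porbit s2 y2.
    by move: Bz; rewrite -!eq_porbit_mem (porbit_perm s2 1).
  by case: eqP => // szx; rewrite szx (negPf Nxy2) in Bsz.
have inl_x2 z : x1 \in porbit s1 z -> inr x2 \in porbit half_splice (inl z).
  by apply: (porbit_follow (f := inl)) => w; rewrite half_inl;
    [move=> _ /negPf -> | move=> ->; rewrite eqxx].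
have inr_x1 z : x2 \in porbit s2 z -> inl x1 \in porbit half_splice (inr z).
  by apply: (porbit_follow (f := inr)) => w; rewrite half_inr;
    [move=> _ /negPf -> | move=> ->; rewrite eqxx].
rewrite porbit_sym in xy1; rewrite porbit_sym in xy2.
have := inr_x1 _ xy2; have := inl_x2 _ xy1; have := inl_x2 _ (porbit_id s1 x1).
by rewrite -!eq_porbit_mem => /eqP-> /eqP-> /eqP->.
Qed.

(** The first transposition merges the cycles of x1 and x2.  The second one
    merges those of y1 and y2, unless they already coincide, when it splits
    their common cycle; this is the case iff both have been merged with the
    cycle of x1 and x2. *)
Lemma card_porbits_splice :
  (#|porbits splice| + 2 = #|porbits s1| + #|porbits s2|
     + ((y1 \in porbit s1 x1) && (y2 \in porbit s2 x2)).*2)%N.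
Proof.
have := porbits_mul_tpermr sum_perm (inl x1) (inr x2).
have := porbits_mul_tpermr half_splice (inl y1) (inr y2).
rewrite porbit_half porbit_sum_inlr card_porbits_sum -/half_splice -/splice.
by case: (_ && _) => /=; lia.
Qed.

End Splice.

End PermutationCycles.

(** * Concatenation of chord diagrams *)

(** Cut the backbone before the endpoint numbered 0.  The two strands of the
    boundary that enter the cut diagram arrive in the states (first, outer) and
    (last, inner); in the closed diagram they lie on a common boundary circle
    iff each of them leaves on the side on which it entered. *)
Definition turns n (D : chord_diagram n) c :=
  [exists p : 'I_n.*2, (p == 0 :> nat) &&
     ((ord_pred p, inner) \in porbit (boundary_perm D c) (p, outer))].

Lemma turnsE n (D : chord_diagram n) c (p : 'I_n.*2) : p = 0 :> nat ->
  turns D c = ((ord_pred p, inner) \in porbit (boundary_perm D c) (p, outer)).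
Proof.
move=> p0; apply/existsP/idP=> [[q /andP[/eqP q0]]|turn]; last by exists p; rewrite p0.
by have -> : q = p by apply: val_inj; rewrite /= q0.
Qed.

(** A relation rather than a function of c, to avoid truncated subtraction and
    halving. *)
Definition genus_is n (D : chord_diagram n) c h :=
  #|porbits (boundary_perm D c)| + h.*2 = n + 2.

Section Concatenation.
Variables (m n : nat) (D1 : chord_diagram m) (D2 : chord_diagram n).
Implicit Types (u : 'I_m.*2 + 'I_n.*2) (p : 'I_(m + n).*2).

Definition concat_pos u : 'I_(m + n).*2 := cast_ord (esym (doubleD m n)) (unsplit u).
Definition split_pos p : 'I_m.*2 + 'I_n.*2 := split (cast_ord (doubleD m n) p).

Lemma concat_posK : cancel concat_pos split_pos.
Proof. by move=> u; rewrite /split_pos /concat_pos cast_ordKV unsplitK. Qed.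

Lemma split_posK : cancel split_pos concat_pos.
Proof. by move=> p; rewrite /split_pos /concat_pos splitK cast_ordK. Qed.

Definition concat_partner p :=
  concat_pos (match split_pos p with
              | inl p1 => inl (partner D1 p1)
              | inr p2 => inr (partner D2 p2)
              end).

Lemma concat_partnerK : involutive concat_partner.
Proof.
move=> p; rewrite -[RHS]split_posK /concat_partner concat_posK.
by case: (split_pos p) => q; rewrite partnerK.
Qed.

Lemma concat_partner_neq p : concat_partner p != p.
Proof.
rewrite -{2}[p]split_posK (can_eq concat_posK).
by case: (split_pos p) => q;
  rewrite (inj_eq (@inl_inj _ _), inj_eq (@inr_inj _ _)) partner_neq.
Qed.

Definition concat : chord_diagram (m + n) :=
  ChordDiagram concat_partnerK concat_partner_neq.

Definition concat_choice (c1 : {ffun 'I_m.*2 -> bool}) (c2 : {ffun 'I_n.*2 -> bool}) :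
    {ffun 'I_(m + n).*2 -> bool} :=
  [ffun p => match split_pos p with inl p1 => c1 p1 | inr p2 => c2 p2 end].

Lemma concat_choice_ex c : exists c1 c2, c = concat_choice c1 c2.
Proof.
exists [ffun p => c (concat_pos (inl p))], [ffun p => c (concat_pos (inr p))].
apply/ffunP=> p; rewrite ffunE -{1}[p]split_posK.
by case: (split_pos p) => q; rewrite ffunE.
Qed.

Variables (first1 : 'I_m.*2) (first2 : 'I_n.*2).
Hypotheses (first1_0 : first1 = 0 :> nat) (first2_0 : first2 = 0 :> nat).

Lemma ordS_concat_inl q :
  ordS (concat_pos (inl q)) =
    concat_pos (if ordS q == first1 then inr first2 else inl (ordS q)).
Proof.
apply: val_inj; rewrite -(inj_eq val_inj) /= first1_0.
have := ltn_ord q; rewrite leq_eqVlt => /orP[/eqP q_last|q_small].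
  by rewrite q_last modnn eqxx /= first2_0 modn_small //; have := ltn_ord first2; lia.
by rewrite (modn_small q_small) /= (modn_small q_small) modn_small //; lia.
Qed.

Lemma ordS_concat_inr q :
  ordS (concat_pos (inr q)) =
    concat_pos (if ordS q == first2 then inl first1 else inr (ordS q)).
Proof.
apply: val_inj; rewrite -(inj_eq val_inj) /= first2_0.
have := ltn_ord q; rewrite leq_eqVlt => /orP[/eqP q_last|q_small].
  by rewrite q_last modnn eqxx /= first1_0 -addnS q_last -doubleD modnn.
by rewrite (modn_small q_small) /= (modn_small q_small) modn_small //; lia.
Qed.

Lemma ord_pred_concat_inl q :
  ord_pred (concat_pos (inl q)) =
    concat_pos (if ord_pred q == ord_pred first1 then inr (ord_pred first2)
                else inl (ord_pred q)).
Proof.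
apply: (can_inj (@ordSK _)); rewrite ord_predK (inj_eq (@ord_pred_inj _)).
case: eqP => [->|/eqP q1]; first by rewrite ordS_concat_inr ord_predK eqxx.
by rewrite ordS_concat_inl ord_predK (negPf q1).
Qed.

Lemma ord_pred_concat_inr q :
  ord_pred (concat_pos (inr q)) =
    concat_pos (if ord_pred q == ord_pred first2 then inl (ord_pred first1)
                else inr (ord_pred q)).
Proof.
apply: (can_inj (@ordSK _)); rewrite ord_predK (inj_eq (@ord_pred_inj _)).
case: eqP => [->|/eqP q1]; first by rewrite ordS_concat_inl ord_predK eqxx.
by rewrite ordS_concat_inr ord_predK (negPf q1).
Qed.

Definition concat_state (x : 'I_m.*2 * bool + 'I_n.*2 * bool) : 'I_(m + n).*2 * bool :=
  match x with
  | inl (p, b) => (concat_pos (inl p), b)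
  | inr (p, b) => (concat_pos (inr p), b)
  end.

Lemma concat_state_bij : bijective concat_state.
Proof.
exists (fun x => match split_pos x.1 with
                 | inl p => inl (p, x.2)
                 | inr p => inr (p, x.2)
                 end).
  by case=> -[p b] /=; rewrite concat_posK.
by case=> p b /=; rewrite -{2}[p]split_posK; case: (split_pos p).
Qed.

Variables (c1 : {ffun 'I_m.*2 -> bool}) (c2 : {ffun 'I_n.*2 -> bool}).
Local Notation s1 := (boundary_perm D1 c1).
Local Notation s2 := (boundary_perm D2 c2).
Local Notation s := (boundary_perm concat (concat_choice c1 c2)).
Local Notation glued := (splice s1 s2 (first1, outer) (ord_pred first1, inner)
                                      (first2, outer) (ord_pred first2, inner)).

(** The backbones of the two diagrams differ from the common backbone only where
    they are cut open, that is, where the walk would come back to one of its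
    entering strands. *)
Lemma concat_stateM x : concat_state (glued x) = s (concat_state x).
Proof.
have crossM y : cross concat (concat_choice c1 c2) (concat_state y) =
    concat_state (match y with
                  | inl z => inl (cross D1 c1 z)
                  | inr z => inr (cross D2 c2 z)
                  end).
  by case: y => -[p b]; rewrite /cross /= ffunE concat_posK;
    case: ifP => //= _; rewrite /concat_partner ffunE !concat_posK.
rewrite boundary_permE crossM.
by case: x => x; rewrite (splice_inl, splice_inr) ?xpair_eqE ?andbF // boundary_permE;
  case: (cross _ _ x) => p [];
  rewrite /advance /= ?(ordS_concat_inl, ordS_concat_inr)
    ?(ord_pred_concat_inl, ord_pred_concat_inr)
    !xpair_eqE ?andbT ?andbF /=; case: ifP.
Qed.

Lemma turns_concat_at : turns concat (concat_choice c1 c2) = turns D1 c1 || turns D2 c2.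
Proof.
have first_0 : concat_pos (inl first1) = 0 :> nat by rewrite /= first1_0.
rewrite (turnsE _ _ first_0) (turnsE _ _ first1_0) (turnsE _ _ first2_0).
rewrite -porbit_splice ?xpair_eqE ?andbF //.
rewrite -(card_porbits_bij concat_state_bij concat_stateM).1 /=.
by rewrite ord_pred_concat_inl eqxx.
Qed.

Lemma genus_concat_at h1 h2 :
    genus_is D1 c1 h1 -> genus_is D2 c2 h2 -> turns D1 c1 && turns D2 c2 <= h1 + h2 ->
  genus_is concat (concat_choice c1 c2) (h1 + h2 - (turns D1 c1 && turns D2 c2)).
Proof.
rewrite /genus_is -(card_porbits_bij concat_state_bij concat_stateM).2.
have : (first1, outer) != (ord_pred first1, inner) by rewrite xpair_eqE andbF.
have : (first2, outer) != (ord_pred first2, inner) by rewrite xpair_eqE andbF.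
move=> neq2 neq1; have := card_porbits_splice s1 s2 neq1 neq2.
rewrite -(turnsE _ _ first1_0) -(turnsE _ _ first2_0).
set k := #|porbits _|; move: (#|porbits s1|) (#|porbits s2|) k => k1 k2 k.
by case: (_ && _) => /=; lia.
Qed.

End Concatenation.

(** * Evaluation of explicit diagrams *)

(** Counting the least element of each cycle makes the number of cycles
    computable by following the permutation alone. *)
Lemma card_porbits_min (T : finType) (s : {perm T}) (f : T -> nat) : injective f ->
  #|porbits s| = #|[set x | [forall y in porbit s x, f x <= f y]]|.
Proof.
move=> f_inj; rewrite -[RHS](@card_in_imset _ _ (porbit s)) => [|x y].
  apply: eq_card => X; apply/imsetP/imsetP=> [] [x x_min ->]; last by exists x.
  have [y yx y_min] := arg_minnP f (porbit_id s x).
  have {}yx : porbit s y = porbit s x by apply/eqP; rewrite eq_porbit_mem.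
  by exists y; rewrite ?yx // inE yx; apply/forall_inP.
rewrite !inE => /forall_inP x_min /forall_inP y_min /eqP xy; apply: f_inj; apply/eqP.
have yx : porbit s y == porbit s x by rewrite eq_sym.
by rewrite eqn_leq x_min ?y_min // -eq_porbit_mem.
Qed.

Lemma mem_traject_porbit (T : finType) (s : {perm T}) x y k : #|T| <= k ->
  (y \in traject s x k) = (y \in porbit s x).
Proof.
move=> le_k; apply/idP/idP=> [/trajectP[i _ ->]|].
  by rewrite -permX mem_porbit.
rewrite porbit_traject => /trajectP[i lt_i ->].
by apply/trajectP; exists i => //; apply: leq_trans lt_i (leq_trans (max_card _) le_k).
Qed.

Lemma map_traject_morph (T U : Type) (f : T -> T) (g : U -> U) (h : T -> U) x k :
  (forall y, h (f y) = g (h y)) -> map h (traject f x k) = traject g (h x) k.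
Proof. by move=> hf; elim: k x => //= k IHk x; rewrite IHk hf. Qed.

Section Words.
Variables (n : nat) (w : seq nat).

(** The word w lists the partners of the endpoints 0, ..., 2n-1.  The functions
    below mirror [boundary_perm] on natural numbers and lists, where they can be
    evaluated by conversion. *)
Definition word_ok :=
  all (fun i => [&& nth 0 w i < n.*2, nth 0 w (nth 0 w i) == i & nth 0 w i != i])
      (iota 0 n.*2).

Hypothesis w_ok : word_ok.

Let word_okP (p : 'I_n.*2) :
  [/\ nth 0 w p < n.*2, nth 0 w (nth 0 w p) = p & nth 0 w p != p].
Proof.
have p_in : (p : nat) \in iota 0 n.*2 by rewrite mem_iota ltn_ord.
by have /and3P[? /eqP ? ?] := allP w_ok _ p_in.
Qed.

Definition word_partner (p : 'I_n.*2) : 'I_n.*2 := insubd p (nth 0 w p).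

Lemma val_word_partner p : word_partner p = nth 0 w p :> nat.
Proof. by rewrite val_insubd; case: (word_okP p) => ->. Qed.

Lemma word_partnerK : involutive word_partner.
Proof.
by move=> p; apply: val_inj; rewrite /= !val_word_partner; case: (word_okP p).
Qed.

Lemma word_partner_neq p : word_partner p != p.
Proof. by rewrite -val_eqE /= val_word_partner; case: (word_okP p). Qed.

Definition word_diagram : chord_diagram n :=
  ChordDiagram word_partnerK word_partner_neq.

Definition word_step (cl : bitseq) (x : nat * bool) : nat * bool :=
  let: (p, b) := if nth false cl x.1 == x.2
                 then (nth 0 w x.1, nth false cl (nth 0 w x.1)) else x in
  (if b then p.+1 %% n.*2 else (p + n.*2).-1 %% n.*2, b).

(** There are 4n states, so 4n steps exhaust each cycle. *)
Definition word_orbit cl x := traject (word_step cl) x n.*2.*2.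

Definition state_code (x : nat * bool) := x.1.*2 + x.2.

Definition is_leader cl x :=
  all (fun y => state_code x <= state_code y) (word_orbit cl x).

Definition word_cycles cl :=
  sumn [seq is_leader cl (p, true) + is_leader cl (p, false) | p <- iota 0 n.*2].

Definition word_turns cl := (n.*2.-1, false) \in word_orbit cl (0, true).

Variable c : {ffun 'I_n.*2 -> bool}.
Local Notation cl := [seq c p | p <- enum 'I_n.*2].
Local Notation s := (boundary_perm word_diagram c).

Let val_state (x : 'I_n.*2 * bool) : nat * bool := (val x.1, x.2).

Let nth_cl (p : 'I_n.*2) : nth false cl p = c p.
Proof. by rewrite (nth_map p) ?size_enum_ord // nth_ord_enum. Qed.

Let val_stateM x : val_state (s x) = word_step cl (val_state x).
Proof.
rewrite boundary_permE /cross /word_step /= nth_cl; case: x => p b /=.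
case: ifP => _ /=; last by case: b.
by rewrite -val_word_partner nth_cl /advance /=; case: (c _).
Qed.

Let val_state_inj : injective val_state.
Proof. by move=> [p b] [q d] [/val_inj -> ->]. Qed.

Let mem_word_orbit x y :
  (val_state y \in word_orbit cl (val_state x)) = (y \in porbit s x).
Proof.
rewrite /word_orbit -(map_traject_morph _ _ val_stateM) (mem_map val_state_inj).
by rewrite mem_traject_porbit // card_prod card_ord card_bool muln2.
Qed.

Let is_leaderE x :
  is_leader cl (val_state x) =
    [forall y in porbit s x, state_code (val_state x) <= state_code (val_state y)].
Proof.
rewrite /is_leader /word_orbit -(map_traject_morph _ _ val_stateM) all_map.
apply/allP/forall_inP=> le_x y; last first.
  rewrite mem_traject_porbit; first exact: le_x.
  by rewrite card_prod card_ord card_bool muln2.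
move=> yx; apply: le_x.
by rewrite mem_traject_porbit // card_prod card_ord card_bool muln2.
Qed.

Lemma word_cyclesE : word_cycles cl = #|porbits s|.
Proof.
rewrite (@card_porbits_min _ s (state_code \o val_state)); last first.
  move=> [p b] [q d]; rewrite /state_code /= => eq_pq.
  have pq : p = q :> nat by case: b d eq_pq => [] [] /=; lia.
  by rewrite (val_inj pq); case: b d eq_pq => [] [] //=; lia.
rewrite /word_cycles sumnE big_map -{1}[n.*2]subn0 -/(index_iota 0 n.*2) big_mkord.
transitivity (\sum_(p < n.*2) \sum_b (is_leader cl (val_state (p, b)) : nat)).
  by apply: eq_bigr => p _; rewrite big_bool.
rewrite (pair_bigA _ (fun p b => (is_leader cl (val_state (p, b)) : nat))) /=.
rewrite -sum1_card [RHS]big_mkcond; apply: eq_bigr => -[p b] _ /=.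
by rewrite is_leaderE !inE; case: ifP.
Qed.

Lemma word_turnsE : 0 < n -> word_turns cl = turns word_diagram c.
Proof.
move=> n_gt0; have n2_gt0 : 0 < n.*2 by rewrite double_gt0.
rewrite (@turnsE _ _ _ (Ordinal n2_gt0)) // -mem_word_orbit /word_turns.
suff -> : (n.*2.-1, false) = val_state (ord_pred (Ordinal n2_gt0), false) by [].
by rewrite /val_state /= add0n modn_small // prednK.
Qed.

End Words.

Fixpoint all_bitseqs k : seq bitseq :=
  if k is k'.+1 then
    [seq true :: v | v <- all_bitseqs k'] ++ [seq false :: v | v <- all_bitseqs k']
  else [:: [::]].

Lemma mem_all_bitseqs k v : (v \in all_bitseqs k) = (size v == k).
Proof.
elim: k v => [|k IHk] [|b v] //=; rewrite mem_cat.
  by apply/orP=> -[] /mapP[].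
rewrite eqSS -IHk; apply/orP/idP=> [[]/mapP[u uk [_ ->]]|vk] //.
by case: b; [left|right]; apply: map_f.
Qed.

(** The first condition includes that the genus of every thickening is a natural
    number; concatenation preserves this. *)
Definition has_profile n (D : chord_diagram n) (L : seq (nat * bool)) :=
  (forall c, exists2 h, genus_is D c h & (h, turns D c) \in L) /\
  (forall h r, (h, r) \in L -> exists2 c, genus_is D c h & turns D c = r).

Definition profile_check n w (L : seq (nat * bool)) :=
  let results :=
    [seq (word_cycles n w cl, word_turns n w cl) | cl <- all_bitseqs n.*2] in
  let matches (r g : nat * bool) := (r.1 + g.1.*2 == n + 2) && (r.2 == g.2) in
  all (fun r => has (matches r) L) results && all (fun g => has (matches^~ g) results) L.

Lemma profile_checkP n w (w_ok : word_ok n w) L : 0 < n -> profile_check n w L ->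
  has_profile (word_diagram w_ok) L.
Proof.
move=> n_gt0 /andP[/allP complete /allP sound]; split=> [c|h r].
  pose cl := [seq c p | p <- enum 'I_n.*2].
  have cl_in : cl \in all_bitseqs n.*2 by rewrite mem_all_bitseqs size_map size_enum_ord.
  have := map_f (fun cl => (word_cycles n w cl, word_turns n w cl)) cl_in.
  move=> /complete/hasP[[h r] hr_L /andP[/= /eqP hE /eqP rE]]; exists h.
    by rewrite /genus_is -word_cyclesE.
  by rewrite -word_turnsE // rE.
move=> /sound/hasP[_ /mapP[v v_in ->] /andP[/= /eqP hE /eqP rE]].
pose c := [ffun p : 'I_n.*2 => nth false v p].
have vE : v = [seq c p | p <- enum 'I_n.*2].
  rewrite mem_all_bitseqs in v_in; apply: (@eq_from_nth _ false).
    by rewrite size_map size_enum_ord (eqP v_in).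
  move=> i; rewrite (eqP v_in) => i_lt.
  by rewrite (nth_map (Ordinal i_lt)) ?size_enum_ord // ffunE nth_enum_ord.
exists c; first by rewrite /genus_is -(word_cyclesE w_ok) -vE.
by rewrite -word_turnsE // -vE.
Qed.

(** * The building blocks *)

Definition arch := word_diagram (isT : word_ok 1 [:: 1; 0]).
Definition crossing := word_diagram (isT : word_ok 2 [:: 2; 3; 0; 1]).
Definition triangle := word_diagram (isT : word_ok 3 [:: 3; 4; 5; 0; 1; 2]).
Definition arched_triangle :=
  word_diagram (isT : word_ok 4 [:: 7; 4; 5; 6; 1; 2; 3; 0]).

Lemma arch_profile : has_profile arch [:: (0, false); (1, true)].
Proof. by apply: profile_checkP => //; vm_compute. Qed.

Lemma crossing_profile : has_profile crossing [:: (0, false); (1, false); (1, true)].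
Proof. by apply: profile_checkP => //; vm_compute. Qed.

(** A band that joins the two circles creates genus, and so do two crossing bands
    on the same circle; with three pairwise crossing chords one of these always
    occurs, which excludes genus 0.  Genus 2 leaves a single boundary
    circle, which contains both strands, so that the diagram turns. *)
Lemma triangle_profile : has_profile triangle [:: (1, false); (1, true); (2, true)].
Proof. by apply: profile_checkP => //; vm_compute. Qed.

(** Putting a diagram under an arch whose ends lie on the same circle keeps its
    genus, and the strands pass over it.  If the ends lie on different circles,
    a diagram that turns is again passed at the same genus, while one that does
    not turn gives a turning diagram of genus one more.  Applied to the pairs of
    the triangle this yields (1, no), (2, no) and (2, yes). *)
Lemma arched_triangle_profile :
  has_profile arched_triangle [:: (1, false); (2, false); (2, true)].
Proof. by apply: profile_checkP => //; vm_compute. Qed.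

(** * Genus ranges of concatenations *)

(** P bounds the pairs (genus, turns), and carries what the next concatenation
    has to know about D. *)
Definition spans n (P : nat -> bool -> bool) lo hi (D : chord_diagram n) :=
  (forall c, exists2 h, genus_is D c h & P h (turns D c)) /\
  (forall k, lo <= k <= hi -> exists c, genus_is D c k).

(** The condition [r <= h], that turning diagrams have positive genus, is what
    makes room for the 1 that is lost when two of them are concatenated. *)
Definition within lo hi h (r : bool) := (lo <= h <= hi) && (r <= h).

(** The condition [h + ~~ r <= hi] says that the top genus hi is attained only by
    turning, so that a turning arch in front of the diagram cannot raise it. *)
Definition within_turning_top lo hi h (r : bool) :=
  within lo hi h r && (h + ~~ r <= hi).

Lemma profile_spans n (D : chord_diagram n) L P lo hi :
    has_profile D L -> all (fun x => P x.1 x.2) L ->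
    (forall k, lo <= k <= hi -> k \in unzip1 L) ->
  spans P lo hi D.
Proof.
move=> [complete sound] /allP P_L lohi; split=> [c|k /lohi/mapP[[h r] hr_L /= ->]].
  by have [h hE /P_L] := complete c; exists h.
by have [c hE _] := sound _ _ hr_L; exists c.
Qed.

(** Every genus of the new range is obtained with a part D1 that does not turn,
    so that nothing is lost in the sum. *)
Lemma concat_spans m n (D1 : chord_diagram m) (D2 : chord_diagram n) L P lo hi
    (P' : nat -> bool -> bool) lo' hi' :
    0 < m -> 0 < n -> has_profile D1 L -> spans P lo hi D2 ->
    (forall h1 r1 h2 r2, (h1, r1) \in L -> P h2 r2 ->
       r1 && r2 <= h1 + h2 /\ P' (h1 + h2 - (r1 && r2)) (r1 || r2)) ->
    (forall k, lo' <= k <= hi' ->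
       exists h1 h2, [/\ (h1, false) \in L, lo <= h2 <= hi & k = h1 + h2]) ->
  spans P' lo' hi' (concat D1 D2).
Proof.
rewrite -(double_gt0 m) -(double_gt0 n) => m_gt0 n_gt0.
move=> [complete sound] [D2_P D2_all] P_P' attain.
have turns_concat c1 c2 :
    turns (concat D1 D2) (concat_choice c1 c2) = turns D1 c1 || turns D2 c2.
  exact: (@turns_concat_at _ _ _ _ (Ordinal m_gt0) (Ordinal n_gt0)).
have genus_concat :=
  @genus_concat_at _ _ D1 D2 (Ordinal m_gt0) (Ordinal n_gt0) erefl erefl.
split=> [c|k /attain[h1 [h2 [h1_L /D2_all[c2 c2E] ->]]]].
  have [c1 [c2 ->]] := concat_choice_ex c.
  have [h1 h1E h1_L] := complete c1; have [h2 h2E h2_P] := D2_P c2.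
  have [le_h h_P'] := P_P' _ _ _ _ h1_L h2_P.
  by eexists; [exact: genus_concat h1E h2E le_h | rewrite turns_concat].
have [c1 c1E turns_c1] := sound _ _ h1_L.
exists (concat_choice c1 c2).
by have := genus_concat _ _ _ _ c1E c2E; rewrite turns_c1 /= subn0; apply.
Qed.

Definition realizable n P lo hi := exists D : chord_diagram n, spans P lo hi D.

Lemma arch_step n lo hi : 0 < n ->
  realizable n (within_turning_top lo hi) lo hi ->
  realizable n.+1 (within_turning_top lo hi) lo hi.
Proof.
move=> n_gt0 [D D_spans]; exists (concat arch D).
apply: concat_spans arch_profile D_spans _ _ => // [h1 r1 h2 r2|k lo_k_hi].
  by rewrite !inE !xpair_eqE /within_turning_top /within => /orP[] /andP[/eqP-> /eqP->];
     case: r2 => /=; lia.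
by exists 0, k.
Qed.

Lemma crossing_step n lo hi : 0 < n -> lo <= hi ->
  realizable n (within lo hi) lo hi -> realizable n.+2 (within lo hi.+1) lo hi.+1.
Proof.
move=> n_gt0 lo_hi [D D_spans]; exists (concat crossing D).
apply: concat_spans crossing_profile D_spans _ _ => // [h1 r1 h2 r2|k lo_k_hi].
  by rewrite !inE !xpair_eqE /within => /or3P[] /andP[/eqP-> /eqP->]; case: r2 => /=; lia.
case: (leqP k hi) => k_hi; first by exists 0, k; split=> //; lia.
by exists 1, hi; split=> //; lia.
Qed.

(** The lower bound rises even if both parts turn, for the arched triangle then
    has genus 2 and still adds 2 - 1. *)
Lemma arched_triangle_step n lo hi : 0 < n -> lo <= hi ->
  realizable n (within lo hi) lo hi -> realizable n.+4 (within lo.+1 hi.+2) lo.+1 hi.+2.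
Proof.
move=> n_gt0 lo_hi [D D_spans]; exists (concat arched_triangle D).
apply: concat_spans arched_triangle_profile D_spans _ _ => // [h1 r1 h2 r2|k lo_k_hi].
  by rewrite !inE !xpair_eqE /within => /or3P[] /andP[/eqP-> /eqP->]; case: r2 => /=; lia.
case: (leqP k hi.+1) => k_hi; first by exists 1, k.-1; split=> //; lia.
by exists 2, hi; split=> //; lia.
Qed.

Lemma arches_realizable n : realizable n.+1 (within_turning_top 0 1) 0 1.
Proof.
elim: n => [|n IHn]; last exact: arch_step IHn.
exists arch; apply: profile_spans arch_profile _ _ => // k.
by rewrite /= !inE; lia.
Qed.

Lemma triangle_arches_realizable n : realizable (n + 3) (within_turning_top 1 2) 1 2.
Proof.
elim: n => [|n IHn]; last by apply: arch_step IHn; lia.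
exists triangle; apply: profile_spans triangle_profile _ _ => // k.
by rewrite /= !inE; lia.
Qed.

Lemma realizable_within n lo hi :
  realizable n (within_turning_top lo hi) lo hi -> realizable n (within lo hi) lo hi.
Proof.
case=> D [D_P D_all]; exists D; split=> // c.
by have [h hE /andP[h_within _]] := D_P c; exists h.
Qed.

Lemma crossings_realizable b n lo hi : 0 < n -> lo <= hi ->
  realizable n (within lo hi) lo hi ->
  realizable (b.*2 + n) (within lo (b + hi)) lo (b + hi).
Proof.
move=> n_gt0 lo_hi D; elim: b => // b IHb.
by rewrite doubleS !addSn; apply: crossing_step IHb; lia.
Qed.

Lemma arched_triangles_realizable a n lo hi : 0 < n -> lo <= hi ->
  realizable n (within lo hi) lo hi ->
  realizable (a * 4 + n) (within (a + lo) (a.*2 + hi)) (a + lo) (a.*2 + hi).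
Proof.
move=> n_gt0 lo_hi D; elim: a => // a IHa.
by rewrite mulSn -addnA doubleS !addSn add0n; apply: arched_triangle_step IHa; lia.
Qed.

Lemma arched_triangle_realizable : realizable 4 (within 1 2) 1 2.
Proof.
exists arched_triangle; apply: profile_spans arched_triangle_profile _ _ => // k.
by rewrite /= !inE; lia.
Qed.

Lemma realizable_genus_range n lo hi : realizable n (within lo hi) lo hi ->
  exists D : chord_diagram n, forall k : int, genus_range D k <-> (lo%:Z <= k <= hi%:Z)%R.
Proof.
case=> D [D_within D_all]; exists D => k; split=> [[c /has_genus_thickened kE]|k_lohi].
  have [h] := D_within c; rewrite /genus_is /within => hE /andP[lo_h_hi _].
  lia.
have [h kE] : exists h : nat, k = h by exists `|k|%N; lia.
have [|c] := D_all h; first by lia.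
by rewrite /genus_is => hE; exists c; apply/has_genus_thickened; lia.
Qed.

(** * The realization theorem *)

Local Open Scope ring_scope.

Theorem theorem6p1 (n : nat) (g g' : int)
    (n_gt0 : (0 < n)%N)
    (g'_le : g' <= (uphalf n)%:Z) :
  (g' = 2 * g /\ (g = 1 \/ g' = (uphalf n)%:Z))
    \/ (0 <= 2 * g /\ 2 * g < g' /\ g' <= (uphalf n)%:Z) ->
  exists D : chord_diagram n,
    forall k : int, genus_range D k <-> g <= k <= g'.
Proof.
case=> [[g'_2g [g_1|g'_top]]|[g_ge0 [g'_gt _]]].
- have n_ge3 : (2 < n)%N by move: g'_le; rewrite g'_2g g_1 uphalfE; lia.
  have := triangle_arches_realizable (n - 3); rewrite subnK //.
  by move/realizable_within/realizable_genus_range; rewrite g'_2g g_1.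
- have [a gE] : exists a : nat, g = a.+1%:Z.
    by exists (`|g|%N.-1); move: g'_top; rewrite uphalfE; lia.
  have [nE|nE] : n = (a * 4 + 3)%N \/ n = (a * 4 + 4)%N.
    by move: g'_top; rewrite g'_2g gE uphalfE; lia.
  + have base : realizable 3 (within 1 2) 1 2.
      exact: realizable_within (triangle_arches_realizable 0).
    have [//|//|D DE] := realizable_genus_range (arched_triangles_realizable a _ _ base).
    by rewrite nE; exists D => k; rewrite DE; lia.
  have [//|//|D DE] :=
    realizable_genus_range (arched_triangles_realizable a _ _ arched_triangle_realizable).
  by rewrite nE; exists D => k; rewrite DE; lia.
have [a gE] : exists a : nat, g = a by exists `|g|%N; lia.
have [h hE] : exists h : nat, g' = (a.*2 + h.+1)%N%:Z.
  by exists (`|g'|%N - a.*2).-1%N; lia.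
(* h crossings, and m + 1 arches: one as the base and m in front of it. *)
have [m nE] : exists m, n = (a * 4 + (h.*2 + m.+1))%N.
  by exists (n - (a * 4 + h.*2).+1)%N; move: g'_le; rewrite hE uphalfE; lia.
have base := realizable_within (arches_realizable m).
have crossed := crossings_realizable h (ltn0Sn m) (leq0n 1) base.
have [||D DE] := realizable_genus_range (arched_triangles_realizable a _ _ crossed).
- by rewrite addnS.
- by [].
by rewrite nE; exists D => k; rewrite DE; lia.
Qed.
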